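(* Let $\underline{q}=(q_n)_{n\ge1}$ be an increasing sequence of positive integers and let $\underline{u}=(u_n)_{n\ge1}$ be an increasing sequence of positive real numbers such that $u_{n+1}\ge u_n+1$ for all $n$. Then ${\sf S}_{\underline{q},\underline{u}}$ is nonempty if and only if $$\limsup_{n\to\infty}\frac{\log q_{n+1}}{u_n\log q_n}>0.$$ Moreover, if ${\sf S}_{\underline{q},\underline{u}}$ is nonempty, then it has the cardinality of the continuum.
   Context: For $x\in\mathbb{R}$, $\Vert x\Vert=\min_{m\in\mathbb{Z}}|x-m|$. A Liouville number is an irrational real $\xi$ such that for every integer $n\ge1$ there is a rational $p_n/q_n$ with $q_n\ge 2$ and $0<|\xi-p_n/q_n|\le q_n^{-n}$; $\mathbb{L}$ denotes the set of Liouville numbers. For an increasing sequence $\underline{q}=(q_n)$ of positive integers and a sequence $\underline{u}=(u_n)$ of positive reals tending to infinity, ${\sf S}_{\underline{q},\underline{u}}$ is the set of $\xi\in\mathbb{L}$ for which there exist constants $\kappa_1,\kappa_2>0$ and a sequence $(b_n)_{n\ge1}$ of positive integers with $1\le b_n\le q_n^{\kappa_1}$ and $\Vert b_n\xi\Vert\le q_n^{-\kappa_2 u_n}$ for every $n$. *)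

(* Defs.v *)
From HB Require Import structures.
From mathcomp Require Import all_boot all_order all_algebra.
From mathcomp Require Import all_classical all_reals all_analysis.
Set Implicit Arguments.
Unset Strict Implicit.
Unset Printing Implicit Defensive.
Import Order.TTheory GRing.Theory Num.Theory.
Local Open Scope classical_set_scope.
Local Open Scope ring_scope.

Definition dist_int (R : realType) (x : R) : R :=
  inf [set `|x - m%:~R| | m in [set: int]].

(* The infimum is attained, so [dist_int x] is the minimum over the integers. *)
Lemma dist_intP (R : realType) (x : R) :
  (exists m : int, dist_int x = `|x - m%:~R|) /\
  (forall m : int, dist_int x <= `|x - m%:~R|).
Proof.
pose D := [set `|x - m%:~R| | m in [set: int]].
have lbD : lbound D 0 by move=> _ [m _ <-]; exact: normr_ge0.
have le_inf (k : int) : dist_int x <= `|x - k%:~R|.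
  by apply: ge_inf; [exists 0 | exists k].
split=> //.
pose f := Num.floor x.
have fle : f%:~R <= x by exact: Num.Theory.floor_le.
have ltf : x < (f + 1)%:~R by exact: Num.Theory.floorD1_gt.
have ef : `|x - f%:~R| = x - f%:~R by rewrite ger0_norm// subr_ge0.
have ec : `|x - (f + 1)%:~R| = (f + 1)%:~R - x.
  by rewrite distrC ger0_norm// subr_ge0 ltW.
have key (m : int) :
    Num.min `|x - f%:~R| `|x - (f + 1)%:~R| <= `|x - m%:~R|.
  rewrite ge_min ef ec; have [mf|fm] := leP m f.
    apply/orP; left; apply: (le_trans _ (ler_norm _)).
    by rewrite lerD2l lerN2 ler_int.
  apply/orP; right; rewrite distrC; apply: (le_trans _ (ler_norm _)).
  by rewrite lerD2r ler_int lezD1.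
have ge_min_inf : Num.min `|x - f%:~R| `|x - (f + 1)%:~R| <= dist_int x.
  apply: lb_le_inf; first by exists `|x - 0%:~R|; exists 0.
  by move=> _ [m _ <-].
have [h|h] := leP `|x - f%:~R| `|x - (f + 1)%:~R|.
  exists f; apply: le_anti; rewrite le_inf /=.
  by move: ge_min_inf; rewrite min_l.
exists (f + 1); apply: le_anti; rewrite le_inf /=.
by move: ge_min_inf; rewrite min_r// ltW.
Qed.

Definition liouville (R : realType) : set R :=
  [set xi | irrational xi /\
    forall n : nat, (1 <= n)%N ->
      exists (p : int) (d : nat), (2 <= d)%N /\
        0 < `|xi - p%:~R / d%:R| <= d%:R ^- n].

(* Sequences (q_n)_{n >= 1} are functions on [nat] whose value at 0 is never
   constrained.  The constants kappa1, kappa2 do not depend on n. *)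
Definition liouville_set (R : realType) (q : nat -> nat) (u : nat -> R) :
    set R :=
  [set xi | liouville xi /\
    exists (kappa1 kappa2 : R) (b : nat -> nat),
      [/\ 0 < kappa1, 0 < kappa2 &
        forall n : nat, (1 <= n)%N ->
          [/\ (1 <= b n)%N,
              (b n)%:R <= (q n)%:R `^ kappa1 &
              dist_int ((b n)%:R * xi) <= (q n)%:R `^ (- kappa2 * u n)]]].

(* Main.v *)
Require Import Defs.
From HB Require Import structures.
From mathcomp Require Import all_boot all_order all_algebra.
From mathcomp Require Import all_classical all_reals all_analysis.
From mathcomp Require Import zify ring lra.

(** If [xi] lies in the set, the integral cross determinants of
    consecutive approximations a_n / b_n to [xi] are bounded by
    q_{n+1}^kappa1 q_n^(-kappa2 u_n) + q_n^kappa1 q_{n+1}^(-kappa2 u_{n+1}).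
    Were the limit superior zero, they would eventually vanish, so that
    a_n / b_n would be constant and [xi] rational.

    Conversely, if q_{n+1} >= q_n^(c u_n) along a sequence n = nu_k, let 2^m_{k+1}
    be the largest power of 2 not exceeding q_{nu_k + 1}, and put m_0 = 0.  Every
    sum of d_k / 2^m_k with digits d_k in {1, 2} is in the set: take b_n = 2^m_k
    for nu_{k-1} < n <= nu_k.  Distinct digit sequences give distinct sums. *)

Set Implicit Arguments.
Unset Strict Implicit.
Unset Printing Implicit Defensive.

Import Order.TTheory GRing.Theory Num.Theory.
Local Open Scope classical_set_scope.
Local Open Scope ring_scope.

(** * Positive limit superiors and monotone sequences *)

(** The limit superior is the infimum of the suprema of tails. A real [c] strictly below that
    infimum is exceeded by a term of every tail, so the rest of the argument can stay in [R]. *)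
Lemma limn_esup_gt0P (R : realType) (f : nat -> R) :
  (0 < limn_esup (fun n => (f n)%:E))%E <->
  exists2 c : R, 0 < c & forall N, exists2 n, (N <= n)%N & c <= f n.
Proof.
rewrite limn_esup_lim (cvg_lim _ (@cvg_esups_inf _ _))//.
split=> [l_gt0|[c c_gt0 freq]].
  have [c c_gt0 cl] : exists2 c : R,
      0 < c & (c%:E < ereal_inf (range (esups (fun n => (f n)%:E))))%E.
    case: (ereal_inf _) l_gt0 => [l| |]//; last by exists 1; rewrite ?ltry.
    by rewrite lte_fin => l_gt0; exists (l / 2); rewrite ?lte_fin; lra.
  exists c => // N.
  have : (c%:E < esups (fun n => (f n)%:E) N)%E.
    by apply: (lt_le_trans cl); apply: ereal_inf_lbound; exists N.
  move=> /ereal_sup_gt[_ [n /= Nn <-]]; rewrite lte_fin => /ltW cf.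
  by exists n.
apply: (@lt_le_trans _ _ c%:E); first by rewrite lte_fin.
apply: le_ereal_inf_tmp => _ [N _ <-]; have [n Nn cf] := freq N.
apply: (@le_trans _ _ (f n)%:E); first by rewrite lee_fin.
by apply: ereal_sup_ubound; exists n.
Qed.

Lemma int_norm_lt1 (R : realDomainType) (z : int) : `|z%:~R| < 1 :> R -> z = 0.
Proof. by rewrite -intr_norm -[1]/(1%:~R) ltr_int; lia. Qed.

Lemma natX_le_powR (R : realType) (q k : nat) (x : R) :
  (0 < q)%N -> k%:R <= x -> q%:R ^+ k <= q%:R `^ x.
Proof. by move=> q0 kx; rewrite -powR_mulrn// ler_powR// ler1n. Qed.

Lemma ge_of_incr (q : nat -> nat) :
  (forall n, (1 <= n)%N -> (0 < q n)%N) ->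
  (forall n, (1 <= n)%N -> (q n < q n.+1)%N) ->
  forall n, (1 <= n)%N -> (n <= q n)%N.
Proof.
move=> q0 qS; elim=> [//|[_ _|n IH _]]; first exact: q0.
by apply: leq_ltn_trans (qS _ _) => //; exact: IH.
Qed.

Lemma leq_of_incr (q : nat -> nat) :
  (forall n, (1 <= n)%N -> (q n < q n.+1)%N) ->
  forall m n, (1 <= m)%N -> (m <= n)%N -> (q m <= q n)%N.
Proof.
move=> qS m n m1 /subnK <-; elim: (n - m)%N => [//|d IH].
by rewrite addSn (leq_trans IH)// ltnW// qS//; lia.
Qed.

Lemma le_of_incr (R : realType) (u : nat -> R) :
  (forall n, (1 <= n)%N -> u n < u n.+1) ->
  forall m n, (1 <= m)%N -> (m <= n)%N -> u m <= u n.
Proof.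
move=> uS m n m1 /subnK <-; elim: (n - m)%N => [//|d IH].
by rewrite addSn (le_trans IH)// ltW// uS//; lia.
Qed.

(** Asking for [2 <= N] keeps out the index 1, where [q] may take the value 1 and have logarithm
    zero. *)
Lemma unbounded_of_step (R : realType) (u : nat -> R) :
  (forall n, (1 <= n)%N -> 0 < u n) ->
  (forall n, (1 <= n)%N -> u n + 1 <= u n.+1) ->
  forall x : R, exists2 N, (2 <= N)%N & forall n, (N <= n)%N -> x <= u n.
Proof.
move=> u0 uS x; have un n : n%:R <= u n.+1.
  elim: n => [|n IH]; first by rewrite ltW// u0.
  by apply: le_trans (uS _ _) => //; rewrite -natr1 lerD2r.
exists (Num.trunc x).+3 => // -[//|n] Nn.
apply: le_trans (un n); apply: ltW; apply: (lt_le_trans (truncnS_gt x)).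
by rewrite ler_nat; exact: ltnW.
Qed.

Lemma powR_le_of_ln (R : realType) (a b x y : R) : 0 < a -> 0 < b ->
  (a `^ x <= b `^ y) = (x * ln a <= y * ln b).
Proof. by move=> a0 b0; rewrite -!ln_powR ler_ln// posrE powR_gt0. Qed.

(** * Nonemptiness forces a positive limit superior *)

Lemma liouville_set_limsup (R : realType) (q : nat -> nat) (u : nat -> R)
    (xi : R) :
  (forall n : nat, (1 <= n)%N -> (0 < q n)%N) ->
  (forall n : nat, (1 <= n)%N -> (q n < q n.+1)%N) ->
  (forall n : nat, (1 <= n)%N -> 0 < u n) ->
  (forall n : nat, (1 <= n)%N -> u n + 1 <= u n.+1) ->
  liouville_set q u xi ->
  exists2 c : R, 0 < c &
    forall N, exists2 n, (N <= n)%N & c <= ln (q n.+1)%:R / (u n * ln (q n)%:R).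
Proof.
move=> q0 qS u0 uS [[xi_irr _] [k1 [k2 [b [k1_gt0 k2_gt0 bP]]]]].
apply: contrapT => notfreq.
(* The threshold [k2 / (2 * k1)] is what makes q_{n+1}^k1 cost at most half of the exponent
   [k2 * u n]. *)
have [N hN] : exists N, forall n, (N <= n)%N ->
    ln (q n.+1)%:R / (u n * ln (q n)%:R) < k2 / (2 * k1).
  apply: contrapT => /forallNP hN; apply: notfreq; exists (k2 / (2 * k1)).
    by rewrite divr_gt0// mulr_gt0.
  move=> N; apply: contrapT => hn; apply: (hN N) => n Nn.
  by rewrite ltNge; apply/negP => le; apply: hn; exists n.
(* Beyond [U] both [k2 * u n / 2] and [k2 * u n.+1 - k1] are at least 2, so each of the two terms
   bounding the determinant is at most 1/4. *)
have [U U2 hU] := unbounded_of_step u0 uS ((k1 + 4) / k2).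
have q2 n : (2 <= n)%N -> (2 <= q n)%N.
  by move=> n2; apply: (leq_trans n2); apply: ge_of_incr => //; lia.
pose M := maxn N U.
have k2u n : (M <= n)%N -> k1 + 4 <= k2 * u n.
  by move=> Mn; rewrite mulrC -ler_pdivrMr// hU//; lia.
have [a aP] : {a : nat -> int & forall n, (1 <= n)%N ->
    `|(b n)%:R * xi - (a n)%:~R| <= (q n)%:R `^ (- k2 * u n)}.
  apply: (@choice _ _ (fun n z => (1 <= n)%N ->
    `|(b n)%:R * xi - z%:~R| <= (q n)%:R `^ (- k2 * u n))) => n.
  have [[m mE] _] := dist_intP ((b n)%:R * xi).
  by exists m => n1; rewrite -mE; case: (bP n n1).
have q_small n x : (2 <= n)%N -> 2%:R <= x -> (q n)%:R `^ (- x) <= 4^-1 :> R.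
  move=> n2 x2; rewrite powRN lef_pV2 ?posrE ?powR_gt0 ?ltr0n ?q0//; last lia.
  apply: le_trans (natX_le_powR _ x2); last by rewrite q0//; lia.
  have q2R : 2 <= (q n)%:R :> R by rewrite ler_nat q2.
  by nra.
have det0 n : (M <= n)%N ->
    ((b n)%:Z * a n.+1 - (b n.+1)%:Z * a n = 0)%R.
  move=> Mn; apply: (@int_norm_lt1 R).
  have n2 : (2 <= n)%N by lia.
  have n1 : (1 <= n)%N by lia.
  (* In this combination the two multiples of [xi] cancel. *)
  have -> : ((b n)%:Z * a n.+1 - (b n.+1)%:Z * a n)%:~R =
      (b n.+1)%:R * ((b n)%:R * xi - (a n)%:~R)
      - (b n)%:R * ((b n.+1)%:R * xi - (a n.+1)%:~R) :> R.
    by rewrite intrB !intrM -!pmulrn; ring.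
  have [_ bn _] := bP _ n1.
  have [_ bn1 _] := bP n.+1 isT.
  have lnq : 0 < ln (q n)%:R :> R by rewrite ln_gt0// ltr1n q2.
  have qpos : 0 < (q n)%:R :> R by rewrite ltr0n q0.
  have qpos1 : 0 < (q n.+1)%:R :> R by rewrite ltr0n q0.
  have growth : (q n.+1)%:R `^ k1 <= (q n)%:R `^ (k2 * u n / 2) :> R.
    rewrite powR_le_of_ln//.
    have /ltW := hN n (leq_trans (leq_maxl _ _) Mn).
    rewrite ler_pdivrMr ?mulr_gt0 ?u0// => h.
    have := ler_wpM2l (ltW k1_gt0) h.
    suff -> : k1 * (k2 / (2 * k1) * (u n * ln (q n)%:R)) =
       k2 * u n / 2 * ln (q n)%:R by [].
    by field; rewrite gt_eqF.
  have t1 : `|(b n.+1)%:R * ((b n)%:R * xi - (a n)%:~R)| <= 4^-1.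
    rewrite normrM ger0_norm//.
    apply: (@le_trans _ _ ((q n)%:R `^ (k2 * u n / 2) *
        (q n)%:R `^ (- k2 * u n))).
      by apply: ler_pM => //; [exact: le_trans bn1 growth|exact: aP].
    rewrite -powRD; last by rewrite (gt_eqF qpos) implybT.
    have -> : k2 * u n / 2 + - k2 * u n = - (k2 * u n / 2) by field.
    by apply: q_small => //; have := k2u n Mn; lra.
  have t2 : `|(b n)%:R * ((b n.+1)%:R * xi - (a n.+1)%:~R)| <= 4^-1.
    rewrite normrM ger0_norm//.
    apply: (@le_trans _ _ ((q n.+1)%:R `^ k1 * (q n.+1)%:R `^ (- k2 * u n.+1))).
      apply: ler_pM => //; last exact: aP.
      apply: (le_trans bn); apply: ge0_ler_powR; rewrite ?nnegrE//.
        exact: ltW.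
      by rewrite ler_nat ltnW// qS.
    rewrite -powRD; last by rewrite (gt_eqF qpos1) implybT.
    have -> : k1 + - k2 * u n.+1 = - (k2 * u n.+1 - k1) by ring.
    by apply: q_small => //; have := k2u n.+1 (leqW Mn); lra.
  apply: le_lt_trans (ler_normB _ _) _; lra.
have bpos n : (M <= n)%N -> 0 < (b n)%:R :> R.
  by move=> Mn; have [|b1 _ _] := bP n; [lia|rewrite ltr0n].
pose r : R := (a M)%:~R / (b M)%:R.
have rE n : (M <= n)%N -> (a n)%:~R = (b n)%:R * r.
  move=> /subnK <-; elim: (n - M)%N => [|d IH].
    by rewrite add0n /r mulrCA divff ?mulr1// gt_eqF// bpos.
  have hd : (M <= d + M)%N by lia.
  have := congr1 (fun z : int => z%:~R : R) (det0 _ hd).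
  rewrite intrB !intrM -!pmulrn IH addSn => h.
  have b_neq0 : (b (d + M)%N)%:R != 0 :> R by rewrite gt_eqF// bpos.
  by apply: (mulfI b_neq0); lra.
(* Otherwise, for n > 1/|xi - r|, one has |b_n xi - a_n| >= |xi - r| > 1/n >= 1/q_n, while the left
   side is at most q_n^(-k2 u_n) <= 1/q_n. *)
have xi_r : xi = r.
  apply/eqP; rewrite -subr_eq0 -normr_le0 leNgt; apply/negP => d_gt0.
  pose n := maxn M (Num.trunc (`|xi - r|^-1)).+1.
  have Mn : (M <= n)%N by rewrite leq_maxl.
  have n2 : (2 <= n)%N by lia.
  have n1 : (1 <= n)%N by lia.
  have [b1 _ _] := bP n n1.
  have := aP n n1; rewrite (rE n Mn) -mulrBr normrM ger0_norm// => le1.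
  have ltn : `|xi - r|^-1 < n%:R.
    by apply: lt_le_trans (truncnS_gt _) _; rewrite ler_nat leq_maxr.
  have nq : n%:R <= (q n)%:R `^ (k2 * u n) :> R.
    apply: (@le_trans _ _ ((q n)%:R ^+ 1)).
      by rewrite expr1 ler_nat ge_of_incr.
    by apply: natX_le_powR; [exact: q0|have := k2u n Mn; lra].
  move: le1; apply/negP; rewrite -ltNge mulNr powRN.
  apply: (@lt_le_trans _ _ `|xi - r|); last by rewrite ler_peMl// ler1n.
  rewrite invf_plt ?posrE//; last by rewrite powR_gt0 ?ltr0n ?q0.
  exact: lt_le_trans ltn nq.
apply: xi_irr; exists ((a M)%:~R / (b M)%:R); first by [].
by rewrite xi_r fmorph_div/= ratr_int ratr_nat.
Qed.

(** * Lacunary binary sums *)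

(** Digits 1 and 2, rather than 0 and 1, keep every term positive, so the full sum never equals a
    partial sum and the Liouville inequality 0 < |xi - p/d| is strict. *)
Definition lacunary_partial (R : realType) (m : nat -> nat) (e : nat -> bool)
    (k : nat) : R :=
  \sum_(j < k.+1) (1 + e j)%:R / 2 ^+ m j.

(* The sum of [(1 + e j) / 2 ^ m j] over all [j]. *)
Definition lacunary_sum (R : realType) (m : nat -> nat) (e : nat -> bool) : R :=
  sup (range (lacunary_partial R m e)).

Lemma lacunary_partialS (R : realType) m e k :
  lacunary_partial R m e k.+1 =
  lacunary_partial R m e k + (1 + e k.+1)%:R / 2 ^+ m k.+1.
Proof. by rewrite /lacunary_partial big_ord_recr. Qed.

Lemma lacunary_partial_lt (R : realType) m e k :
  lacunary_partial R m e k < lacunary_partial R m e k.+1.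
Proof. by rewrite lacunary_partialS ltrDl divr_gt0// exprn_gt0. Qed.

Lemma lacunary_partial_le (R : realType) m e k l :
  (k <= l)%N -> lacunary_partial R m e k <= lacunary_partial R m e l.
Proof.
move=> /subnK <-; elim: (l - k)%N => [//|d IH].
by rewrite addSn (le_trans IH)// ltW// lacunary_partial_lt.
Qed.

(** The quantity S_i + 4/2^m_{i+1} is nonincreasing in i: with x = 1/2^m_{i+1}, the next term is at
    most 2x and the next allowance at most 4x/8, in total less than 4x. *)
Lemma lacunary_partial_ub (R : realType) m e k l :
  (forall k, m k + 3 <= m k.+1)%N ->
  lacunary_partial R m e l <= lacunary_partial R m e k + 4 / 2 ^+ m k.+1.
Proof.
move=> mS.
have dec i : lacunary_partial R m e i.+1 + 4 / 2 ^+ m i.+2 <=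
    lacunary_partial R m e i + 4 / 2 ^+ m i.+1.
  rewrite lacunary_partialS -addrA lerD2l.
  have p0 : 0 < (2 ^+ m i.+1)^-1 :> R by rewrite invr_gt0 exprn_gt0.
  have p1 : (2 ^+ m i.+2)^-1 <= (2 ^+ m i.+1)^-1 / 8 :> R.
    rewrite -invfM lef_pV2 ?posrE ?mulr_gt0 ?exprn_gt0//.
    have -> : 8 = 2 ^+ 3 :> R by rewrite -natrX.
    by rewrite -exprD ler_eXn2l// ltr1n.
  have p2 : (1 + e i.+1)%:R <= 2 :> R by rewrite ler_nat; case: (e _).
  nra.
have [kl|lk] := leqP k l; last first.
  rewrite (le_trans (lacunary_partial_le R m e (ltnW lk)))// lerDl.
  by rewrite divr_ge0.
suff h : lacunary_partial R m e l + 4 / 2 ^+ m l.+1 <=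
         lacunary_partial R m e k + 4 / 2 ^+ m k.+1.
  by apply: le_trans h; rewrite lerDl divr_ge0.
move: kl => /subnK <-; elim: (l - k)%N => [//|d IH].
by rewrite addSn; apply: le_trans IH.
Qed.

Lemma lacunary_sum_bounds (R : realType) m e k :
  (forall k, m k + 3 <= m k.+1)%N ->
  lacunary_partial R m e k < lacunary_sum R m e
    <= lacunary_partial R m e k + 4 / 2 ^+ m k.+1.
Proof.
move=> mS; apply/andP; split.
  apply: lt_le_trans (lacunary_partial_lt R m e k) _.
  apply: ub_le_sup; last by exists k.+1.
  by exists (lacunary_partial R m e 0 + 4 / 2 ^+ m 1%N) => _ [l _ <-];
    exact: lacunary_partial_ub.
apply: ge_sup; first by exists (lacunary_partial R m e 0), 0%N.
by move=> _ [l _ <-]; exact: lacunary_partial_ub.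
Qed.

Lemma lacunary_partial_int (R : realType) m e k :
  (forall k, m k + 3 <= m k.+1)%N ->
  exists a : nat, lacunary_partial R m e k = a%:R / 2 ^+ m k.
Proof.
move=> mS; elim: k => [|k [a IH]].
  by exists (1 + e 0)%N; rewrite /lacunary_partial big_ord1.
exists (a * 2 ^ (m k.+1 - m k) + (1 + e k.+1))%N.
rewrite lacunary_partialS IH [in RHS]natrD mulrDl natrM natrX.
have le : (m k <= m k.+1)%N by have := mS k; lia.
have -> : 2 ^+ m k.+1 = 2 ^+ (m k.+1 - m k) * 2 ^+ m k :> R.
  by rewrite -exprD subnK.
by congr (_ + _); field; rewrite !expf_neq0.
Qed.

(** At the first index k where the digits differ, the larger digit gains 1/2^m_k, whereas everything
    after k in the other sum is at most 4/2^m_{k+1}, half of that gain. *)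
Lemma lacunary_sum_inj (R : realType) m :
  (forall k, m k + 3 <= m k.+1)%N -> injective (lacunary_sum R m).
Proof.
move=> mS.
have sep e e' k : (forall j, (j < k)%N -> e j = e' j) ->
    e k = false -> e' k = true -> lacunary_sum R m e < lacunary_sum R m e'.
  move=> eq ek ek'.
  have /andP[_ ub] := lacunary_sum_bounds R e k mS.
  have /andP[lb _] := lacunary_sum_bounds R e' k mS.
  apply: le_lt_trans ub _; apply: lt_trans _ lb.
  rewrite /lacunary_partial !big_ord_recr /= ek ek'.
  under eq_bigr do rewrite eq//.
  rewrite -addrA ltrD2l.
  have p0 : 0 < (2 ^+ m k)^-1 :> R by rewrite invr_gt0 exprn_gt0.
  have p1 : (2 ^+ m k.+1)^-1 <= (2 ^+ m k)^-1 / 8 :> R.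
    rewrite -invfM lef_pV2 ?posrE ?mulr_gt0 ?exprn_gt0//.
    have -> : 8 = 2 ^+ 3 :> R by rewrite -natrX.
    by rewrite -exprD ler_eXn2l// ltr1n.
  by rewrite addn0 addn1; lra.
move=> e e' ee'; apply: contrapT => ne.
have ex : exists k, e k != e' k.
  apply: contrapT => /forallNP h; apply: ne; apply/funext => k.
  by apply/eqP; apply: contrapT => /negP; exact: h.
case: (ex_minnP ex) => k nek kmin.
have eqj j : (j < k)%N -> e j = e' j.
  move=> jk; apply/eqP; apply: contraT => nej.
  by have := kmin j nej; rewrite leqNgt jk.
case ek : (e k) nek; case ek' : (e' k) => // _.
  have := sep e' e k (fun j jk => esym (eqj j jk)) ek' ek.
  by rewrite ee' ltxx.
by have := sep e e' k eqj ek ek'; rewrite ee' ltxx.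
Qed.

(** * Members of the set from a positive limit superior *)

(** A rational with denominator b differs from any other fraction p/d by at least 1/(bd). The
    approximation of order b + 1 violates this, since b < d^b. *)
Lemma irrational_of_approx (R : realType) (xi : R) :
  (forall n : nat, (1 <= n)%N ->
    exists (p : int) (d : nat), (2 <= d)%N /\
      0 < `|xi - p%:~R / d%:R| <= d%:R ^- n) ->
  irrational xi.
Proof.
move=> approx [r _ rE].
pose b := `|denq r|%N.
have b0 : (0 < b)%N by rewrite absz_gt0 denq_neq0.
have xiE : xi = (numq r)%:~R / b%:R.
  rewrite -rE /ratr /b; congr (_ / _).
  by rewrite pmulrn gez0_abs// denq_ge0.
have [p [d [d2 /andP[gt0 le]]]] := approx b.+1 isT.
have d0 : 0 < d%:R :> R by rewrite ltr0n; lia.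
have b0' : 0 < b%:R :> R by rewrite ltr0n.
have E : `|xi - p%:~R / d%:R| * (b%:R * d%:R) =
    `|(numq r * d%:Z - p * b%:Z)%:~R|.
  rewrite -[b%:R * _]ger0_norm ?mulr_ge0 ?ltW// -normrM; congr (`|_|).
  by rewrite xiE intrB !intrM -!pmulrn; field; rewrite !gt_eqF.
have nz : numq r * d%:Z - p * b%:Z <> 0.
  by move=> z0; have := mulr_gt0 gt0 (mulr_gt0 b0' d0); rewrite E z0 normr0 ltxx.
apply: nz; apply: (@int_norm_lt1 R); rewrite -E.
apply: (@le_lt_trans _ _ (d%:R ^- b.+1 * (b%:R * d%:R))).
  by rewrite ler_wpM2r// mulr_ge0// ltW.
have -> : d%:R ^- b.+1 * (b%:R * d%:R) = b%:R / d%:R ^+ b :> R.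
  by rewrite exprS; field; rewrite expf_neq0 gt_eqF.
rewrite ltr_pdivrMr ?exprn_gt0// mul1r -natrX ltr_nat.
exact: ltn_expl.
Qed.

(** The exponent drops from [c] to [c / 2] to absorb the factor 2^m_k and the constants. The last
    clause gives the Liouville property; the two before it give the denominators b_n. *)
Lemma lacunary_selection (R : realType) (q : nat -> nat) (u : nat -> R) (c : R) :
  (forall n : nat, (1 <= n)%N -> (0 < q n)%N) ->
  (forall n : nat, (1 <= n)%N -> (q n < q n.+1)%N) ->
  (forall n : nat, (1 <= n)%N -> 0 < u n) ->
  (forall n : nat, (1 <= n)%N -> u n + 1 <= u n.+1) ->
  0 < c ->
  (forall N, exists2 n, (N <= n)%N &
     c <= ln (q n.+1)%:R / (u n * ln (q n)%:R)) ->
  exists nu m : nat -> nat,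
    [/\ forall k, (1 <= nu k < nu k.+1)%N,
        forall k, (m k + 3 <= m k.+1)%N,
        (forall n, (1 <= n)%N -> (2 ^ m 0 <= q n)%N) /\
        forall k n, (nu k < n)%N -> (2 ^ m k.+1 <= q n)%N,
        forall k, 2 ^+ m k * (4 / 2 ^+ m k.+1)
                  <= (q (nu k))%:R `^ (- (c / 2) * u (nu k)) &
        forall N, exists2 k, (0 < m k)%N & (N * m k + 3 <= m k.+1)%N].
Proof.
move=> q0 qS u0 uS c_gt0 freq.
(* Beyond [U] one has c u_n >= 8, so half of this exponent still pays for a factor q_n^4. *)
have [U U2 hU] := unbounded_of_step u0 uS (8 / c).
have q2 n : (2 <= n)%N -> (2 <= q n)%N.
  by move=> n2; apply: (leq_trans n2); apply: ge_of_incr => //; lia.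
have [g gP] : {g : nat -> nat & forall N, (N <= g N)%N /\
    c <= ln (q (g N).+1)%:R / (u (g N) * ln (q (g N))%:R)}.
  apply: (@choice _ _ (fun N n => (N <= n)%N /\
    c <= ln (q n.+1)%:R / (u n * ln (q n)%:R))) => N.
  by have [n Nn cn] := freq N; exists n.
pose nu k := iter k (fun i => g i.+1) (g U).
have nuS k : (nu k < nu k.+1)%N by rewrite /nu iterS; case: (gP (nu k).+1).
have nuU k : (U + k <= nu k)%N.
  elim: k => [|k IH]; first by rewrite addn0; case: (gP U).
  by rewrite addnS; apply: leq_ltn_trans (nuS k).
have nuP k : c <= ln (q (nu k).+1)%:R / (u (nu k) * ln (q (nu k))%:R).
  by case: k => [|k]; [case: (gP U)|case: (gP (nu k).+1)].
have nu2 k : (2 <= nu k)%N by have := nuU k; lia.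
have nu1 k : (1 <= nu k)%N := ltnW (nu2 k).
have cu8 k : 8 <= c * u (nu k).
  by rewrite mulrC -ler_pdivrMr// hU//; have := nuU k; lia.
have growth k : (q (nu k))%:R `^ (c * u (nu k)) <= (q (nu k).+1)%:R :> R.
  rewrite -[leRHS]powRr1 ?ler0n// powR_le_of_ln ?ltr0n ?q0// mul1r -mulrA.
  by rewrite -ler_pdivlMr ?nuP// mulr_gt0 ?u0// ln_gt0// ltr1n q2.
(* The value 0 at 0 yields the denominator 1 for the indices up to [nu 0], where [q] may be as small
   as 1. *)
pose m k := if k is k'.+1 then trunc_log 2 (q (nu k').+1) else 0%N.
have mle k : (2 ^ m k.+1 <= q (nu k).+1)%N by apply: trunc_logP => //; exact: q0.
have mgt k : (q (nu k).+1 < 2 ^ (m k.+1).+1)%N by exact: trunc_log_ltn.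
have mq k n : (nu k < n)%N -> (2 ^ m k.+1 <= q n)%N.
  by move=> kn; apply: leq_trans (mle k) _; exact: leq_of_incr.
have mQ k : (2 ^ m k <= q (nu k))%N by case: k => [|k]; [exact: q0|exact: mq].
(* With Q = q_{nu_k}, the bounds 2^m_k <= Q and 2 <= Q give 2^(N m_k + 3) <= Q^(N + 3) <= q_{nu_k +
   1} < 2^(m_{k+1} + 1). *)
have fast k N : (N + 3)%:R <= c * u (nu k) -> (N * m k + 3 <= m k.+1)%N.
  move=> /(natX_le_powR (q0 _ (nu1 k))) /le_trans/(_ (growth k)).
  rewrite -natrX ler_nat => le.
  have : (2 ^ (N * m k + 3) < 2 ^ (m k.+1).+1)%N.
    apply: leq_ltn_trans (mgt k); apply: leq_trans le.
    rewrite !expnD leq_mul//; last by rewrite leq_exp2r// q2.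
    by rewrite mulnC expnM; case: (N) => [|N']; rewrite ?expn0 ?leq_exp2r.
  by rewrite ltn_exp2l.
have mS k : (m k + 3 <= m k.+1)%N.
  by rewrite -[m k]mul1n; apply: fast; apply: le_trans (cu8 k); rewrite ler_nat.
exists nu, m; split=> //.
- by move=> k; rewrite nu1 nuS.
- move=> k; set Q : R := (q (nu k))%:R.
  have Q2 : 2 <= Q by rewrite ler_nat q2.
  have Q0 : 0 < Q by lra.
  rewrite mulNr powRN mulrA ler_pdivrMr ?exprn_gt0// [leRHS]mulrC ler_pdivlMr ?powR_gt0//.
  have x0 : 0 < 2 ^+ m k.+1 :> R by rewrite exprn_gt0.
  (* The chain is 8 * 2^m_k * Q^(cu/2) <= Q^4 * Q^(cu/2) <= Q^(cu) <= 2 * 2^m_{k+1}, where u is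
     taken at nu_k. *)
  have le1 : Q `^ (c * u (nu k)) <= 2 * 2 ^+ m k.+1.
    rewrite -exprS; apply: le_trans (growth k) _.
    by rewrite -natrX ler_nat ltnW.
  have le2 : 2 ^+ m k <= Q by rewrite -natrX ler_nat.
  have le3 : Q ^+ 4 * Q `^ (c / 2 * u (nu k)) <= Q `^ (c * u (nu k)).
    rewrite -powR_mulrn ?(ltW Q0)// -powRD; last by rewrite (gt_eqF Q0) implybT.
    by apply: ler_powR; [lra|have := cu8 k; lra].
  have P0 : 0 < Q `^ (c / 2 * u (nu k)) by rewrite powR_gt0.
  have le4 : 8 * 2 ^+ m k <= Q ^+ 4.
    have Q3 : 8 <= Q ^+ 3 by rewrite !exprS expr0; nra.
    by rewrite exprSr; apply: ler_pM => //; lra.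
  nra.
- move=> N; have [V V2 hV] := unbounded_of_step u0 uS ((N + 3)%:R / c).
  (* The successor guarantees [0 < m V.+1], and [nu V.+1] lies beyond [V]. *)
  exists V.+1; first by have := mS V; lia.
  apply: fast; rewrite mulrC -ler_pdivrMr// hV//; have := nuU V.+1; lia.
Qed.

Lemma lacunary_sum_liouville_set (R : realType) (q : nat -> nat)
    (u : nat -> R) (c : R) (nu m : nat -> nat) (e : nat -> bool) :
  (forall n : nat, (1 <= n)%N -> (0 < q n)%N) ->
  (forall n : nat, (1 <= n)%N -> (q n < q n.+1)%N) ->
  (forall n : nat, (1 <= n)%N -> 0 < u n) ->
  (forall n : nat, (1 <= n)%N -> u n < u n.+1) ->
  0 < c ->
  (forall k, (1 <= nu k < nu k.+1)%N) ->
  (forall k, (m k + 3 <= m k.+1)%N) ->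
  (forall n, (1 <= n)%N -> (2 ^ m 0 <= q n)%N) ->
  (forall k n, (nu k < n)%N -> (2 ^ m k.+1 <= q n)%N) ->
  (forall k, 2 ^+ m k * (4 / 2 ^+ m k.+1) <= (q (nu k))%:R `^ (- c * u (nu k))) ->
  (forall N, exists2 k, (0 < m k)%N & (N * m k + 3 <= m k.+1)%N) ->
  liouville_set q u (lacunary_sum R m e).
Proof.
move=> q0 qS u0 uS c_gt0 nuS mS mq0 mqS small sparse.
set xi := lacunary_sum R m e.
have bounds k : 0 < xi - lacunary_partial R m e k <= 4 / 2 ^+ m k.+1.
  by have := lacunary_sum_bounds R e k mS; rewrite subr_gt0 lerBlDl.
have approx n : (1 <= n)%N -> exists (p : int) (d : nat), (2 <= d)%N /\
    0 < `|xi - p%:~R / d%:R| <= d%:R ^- n.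
  (* The fraction is the k-th partial sum, over 2^m_k: its error 4/2^m_{k+1} is below 2^(-n m_k)
     because m_{k+1} >= n m_k + 3. *)
  move=> _; have [k mk0 mk] := sparse n.
  have [a aE] := lacunary_partial_int R e k mS.
  exists a%:Z, (2 ^ m k)%N; split; first by rewrite -[2%N]/(2 ^ 1)%N leq_exp2l.
  have /andP[gt0 le] := bounds k.
  rewrite natrX -pmulrn -aE (ger0_norm (ltW gt0)) gt0 /=.
  apply: (le_trans le); rewrite -exprM mulnC.
  rewrite ler_pdivrMr ?exprn_gt0// mulrC ler_pdivlMr ?exprn_gt0//.
  have -> : 4 = 2 ^+ 2 :> R by rewrite -natrX.
  by rewrite -exprD ler_eXn2l ?ltr1n//; lia.
split; first by split=> //; exact: irrational_of_approx.
have [b bP] : {b : nat -> nat & forall n, (1 <= n)%N ->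
   [/\ (1 <= b n)%N, (b n)%:R <= (q n)%:R `^ 1 :> R &
     dist_int ((b n)%:R * xi) <= (q n)%:R `^ (- c * u n)]}.
  apply: (@choice _ _ (fun n b => (1 <= n)%N ->
   [/\ (1 <= b)%N, b%:R <= (q n)%:R `^ 1 :> R &
     dist_int (b%:R * xi) <= (q n)%:R `^ (- c * u n)])) => n.
  have ex : exists k, (n <= nu k)%N.
    exists n; elim: n => [//|n IH].
    by apply: leq_ltn_trans IH _; case/andP: (nuS n).
  (* Minimality of [k] gives nu_{k-1} < n when k > 0, hence 2^m_k <= q_n, which allows kappa1 =
     1. *)
  case: (ex_minnP ex) => k nk kmin.
  exists (2 ^ m k)%N => n1; split; first by rewrite expn_gt0.
    rewrite powRr1 ?ler0n// ler_nat; case: k kmin {nk} => [|k] kmin.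
      exact: mq0.
    by apply: mqS; rewrite ltnNge; apply/negP => /kmin; rewrite ltnn.
  have [a aE] := lacunary_partial_int R e k mS.
  have [_ /(_ a%:Z)] := dist_intP ((2 ^ m k)%:R * xi).
  move=> /le_trans; apply; have /andP[gt0 le] := bounds k.
  have -> : (2 ^ m k)%:R * xi - a%:Z%:~R =
      2 ^+ m k * (xi - lacunary_partial R m e k).
    by rewrite natrX -pmulrn aE; field; rewrite expf_neq0.
  rewrite ger0_norm; last by rewrite mulr_ge0 ?exprn_ge0 ?(ltW gt0).
  apply: (@le_trans _ _ (2 ^+ m k * (4 / 2 ^+ m k.+1))).
    by rewrite ler_wpM2l// exprn_ge0.
  apply: (le_trans (small k)).
  have nu1 : (1 <= nu k)%N by case/andP: (nuS k).
  (* As n <= nu_k, both the base and the exponent grow from n to nu_k, so the bound at nu_k implies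
     the one at n. *)
  rewrite !mulNr !powRN lef_pV2 ?posrE ?powR_gt0 ?ltr0n ?q0//.
  apply: (@le_trans _ _ ((q n)%:R `^ (c * u (nu k)))).
    apply: ler_powR; first by rewrite ler1n q0.
    by rewrite ler_pM2l//; exact: le_of_incr.
  apply: ge0_ler_powR; rewrite ?nnegrE//; first by rewrite mulr_ge0 ?(ltW c_gt0) ?(ltW (u0 _ nu1)).
  by rewrite ler_nat; exact: leq_of_incr.
by exists 1, c, b; split.
Qed.

(** * Cardinality of the continuum *)

(* A real number is determined by the rationals below it. *)
Lemma card_real_le (R : realType) (S : set R) (f : (nat -> bool) -> R) :
  injective f -> (forall e, S (f e)) -> (S #= [set: R])%card.
Proof.
move=> f_inj fS; apply: Cantor_Bernstein.
  by apply: subset_card_le => x _.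
(* Composing [f] with [cut] embeds the reals into [S]. Codes of no rational receive [false] for
   every real, so only rational codes separate points. *)
pose cut (x : R) (n : nat) : bool :=
  if unpickle n is Some r then ratr (r : rat) < x else false.
have cut_inj : injective cut.
  have sep x y : x < y -> cut x <> cut y.
    move=> xy E; have [r] := rat_in_itvoo xy.
    rewrite in_itv/= => /andP[xr ry].
    have := congr1 (fun h => h (pickle r)) E.
    by rewrite /cut pickleK ry (lt_gtF xr).
  move=> x y E; apply: le_anti; rewrite !leNgt.
  by apply/andP; split; apply/negP => /sep; [apply; rewrite E|apply].
have /injfunPex[g] : exists2 g : R -> R, set_fun [set: R] S g & set_inj [set: R] g.
  by exists (f \o cut) => [x _|x y _ _ /f_inj/cut_inj]; [exact: fS|].
exact: inj_card_le.
Qed.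

(* The limit superior is taken in the extended reals.  If q 1 = 1 the quotient
   at n = 1 is the junk value 0, and its value at n = 0 is arbitrary; neither
   affects the limit superior. *)
Theorem theorem1p4 (R : realType) (q : nat -> nat) (u : nat -> R)
  (q_gt0 : forall n : nat, (1 <= n)%N -> (0 < q n)%N)
  (q_incr : forall n : nat, (1 <= n)%N -> (q n < q n.+1)%N)
  (u_gt0 : forall n : nat, (1 <= n)%N -> 0 < u n)
  (u_incr : forall n : nat, (1 <= n)%N -> u n < u n.+1)
  (u_step : forall n : nat, (1 <= n)%N -> u n + 1 <= u n.+1) :
  (liouville_set q u !=set0 <->
    (0 < limn_esup (fun n : nat =>
           (ln (q n.+1)%:R / (u n * ln (q n)%:R))%:E))%E) /\
  (liouville_set q u !=set0 -> (liouville_set q u #= [set: R])%card).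
Proof.
have limsup_gt0 : liouville_set q u !=set0 -> (0 < limn_esup (fun n : nat =>
    (ln (q n.+1)%:R / (u n * ln (q n)%:R))%:E))%E.
  move=> [xi xiS]; apply/limn_esup_gt0P.
  exact: (liouville_set_limsup q_gt0 q_incr u_gt0 u_step xiS).
have family : (0 < limn_esup (fun n : nat =>
    (ln (q n.+1)%:R / (u n * ln (q n)%:R))%:E))%E ->
    exists2 f : (nat -> bool) -> R, injective f &
      forall e, liouville_set q u (f e).
  move=> /limn_esup_gt0P[c c_gt0 freq].
  have [nu [m [nuS mS [mq0 mqS] small sparse]]] :=
    lacunary_selection q_gt0 q_incr u_gt0 u_step c_gt0 freq.
  exists (lacunary_sum R m); first exact: lacunary_sum_inj.
  have c2_gt0 : 0 < c / 2 by rewrite divr_gt0.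
  by move=> e; exact: (lacunary_sum_liouville_set e q_gt0 q_incr u_gt0 u_incr
    c2_gt0 nuS mS mq0 mqS small sparse).
split; first split=> //.
  by move=> /family[f _ fS]; exists (f xpredT).
by move=> /limsup_gt0/family[f f_inj fS]; exact: card_real_le f_inj fS.
Qed.
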